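(* There exists a $3$-tensor with rational entries whose rank over $\mathbb{R}$ is strictly less than its rank over $\mathbb{Q}$.
   Context: For a field $\mathbb{K}$ and $\mathcal{A}\in\mathbb{K}^{l\times m\times n}$, the rank of $\mathcal{A}$ over $\mathbb{K}$ is the minimum $r$ such that $\mathcal{A}=\sum_{\alpha=1}^r\mathbf{x}_\alpha\otimes\mathbf{y}_\alpha\otimes\mathbf{z}_\alpha$ with $\mathbf{x}_\alpha\in\mathbb{K}^l,\mathbf{y}_\alpha\in\mathbb{K}^m,\mathbf{z}_\alpha\in\mathbb{K}^n$, where $\mathbf{x}\otimes\mathbf{y}\otimes\mathbf{z}=[\![x_iy_jz_k]\!]$. *)

(* Defs.v *)
From mathcomp Require Import all_boot all_algebra.
From mathcomp Require Import boolp reals.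

Set Implicit Arguments.
Unset Strict Implicit.
Unset Printing Implicit Defensive.

Import GRing.Theory.
Local Open Scope ring_scope.

Definition tensor3 (K : fieldType) (l m n : nat) :=
  {ffun 'I_l * 'I_m * 'I_n -> K}.

Definition outer3 (K : fieldType) (l m n : nat)
    (x : 'rV[K]_l) (y : 'rV[K]_m) (z : 'rV[K]_n) : tensor3 K l m n :=
  [ffun p : 'I_l * 'I_m * 'I_n => x 0 p.1.1 * y 0 p.1.2 * z 0 p.2].

Definition has_decomposition (K : fieldType) (l m n : nat)
    (A : tensor3 K l m n) (r : nat) : Prop :=
  exists (x : 'I_r -> 'rV[K]_l) (y : 'I_r -> 'rV[K]_m) (z : 'I_r -> 'rV[K]_n),
    A = \sum_(a < r) outer3 (x a) (y a) (z a).

Lemma has_decomposition_ex (K : fieldType) (l m n : nat)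
    (A : tensor3 K l m n) : exists r, `[< has_decomposition A r >].
Proof.
pose T : finType := ('I_l * 'I_m * 'I_n)%type.
exists #|T|; apply/asboolP.
exists (fun a => let p : T := enum_val a in A p *: delta_mx 0 p.1.1).
exists (fun a => let p : T := enum_val a in delta_mx 0 p.1.2).
exists (fun a => let p : T := enum_val a in delta_mx 0 p.2).
apply/ffunP => -[[i j] k]; rewrite sum_ffunE.
pose q : T := (i, j, k).
rewrite (bigD1 (enum_rank q)) //= big1 => [|a neq_a].
  by rewrite ffunE enum_rankK !mxE !eqxx !mulr1 addr0.
rewrite ffunE !mxE !eqxx /=.
have : enum_val a != q by rewrite -(inj_eq enum_rank_inj) enum_valK.
case: (enum_val a) => -[i' j'] k' /=.
rewrite /q !xpair_eqE -!andbA (eq_sym i) (eq_sym j) (eq_sym k).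
by case: (i' == i); case: (j' == j); case: (k' == k);
  rewrite //= ?mulr0 ?mul0r.
Qed.

Definition tensor_rank (K : fieldType) (l m n : nat) (A : tensor3 K l m n)
  : nat := ex_minn (has_decomposition_ex A).

Definition map_tensor3 (K L : fieldType) (f : K -> L) (l m n : nat)
    (A : tensor3 K l m n) : tensor3 L l m n := [ffun p => f (A p)].

(* Main.v *)
(** Take the 2 x 2 x 2 tensor with slices the identity and the companion matrix
    [M] of [X^2 - c], and let [u + v M] be a combination of these slices.  If
    [s^2 = c], then [M] is diagonalizable with eigenvalues [s] and [-s], which
    gives a decomposition into two terms.  Conversely, a decomposition
    [sum_(a < 2) x_a (x) y_a (x) z_a] gives
    [u^2 - c v^2 = det(u + v M) = det(x) det(y) prod_a (u z_a0 + v z_a1)],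
    and choosing [(u, v)] orthogonal to [z_0] exhibits a square root of [c].
    The theorem is the case [c = 2]. *)
Require Import Defs.
From mathcomp Require Import all_boot all_order all_algebra.
From mathcomp Require Import boolp reals.
From mathcomp Require Import ring.

Set Implicit Arguments.
Unset Strict Implicit.
Unset Printing Implicit Defensive.

Import Order.TTheory GRing.Theory Num.Theory.
Local Open Scope ring_scope.

Lemma has_decompositionS (K : fieldType) (l m n : nat) (A : tensor3 K l m n)
    (r : nat) :
  has_decomposition A r -> has_decomposition A r.+1.
Proof.
move=> [x [y [z ->]]].
exists (fun a => if unlift ord0 a is Some b then x b else 0).
exists (fun a => if unlift ord0 a is Some b then y b else 0).
exists (fun a => if unlift ord0 a is Some b then z b else 0).
rewrite big_ord_recl unlift_none.
have -> : outer3 0 0 0 = 0 :> tensor3 K l m n.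
  by apply/ffunP => p; rewrite !ffunE !mxE !mul0r.
by rewrite add0r; apply: eq_bigr => a _; rewrite liftK.
Qed.

Lemma has_decomposition_leq (K : fieldType) (l m n : nat) (A : tensor3 K l m n)
    (r s : nat) :
  (r <= s)%N -> has_decomposition A r -> has_decomposition A s.
Proof.
move=> /subnK <-; elim: (s - r)%N => // k IHk Ar.
by rewrite addSn; apply/has_decompositionS/IHk.
Qed.

(** A decomposition of minimal length can be padded with zero terms, so rank bounds become questions
    about exactly [r] terms. *)
Lemma tensor_rank_leP (K : fieldType) (l m n : nat) (A : tensor3 K l m n)
    (r : nat) :
  reflect (has_decomposition A r) (tensor_rank A <= r)%N.
Proof.
rewrite /tensor_rank; case: ex_minnP => s /asboolP As s_min.
apply: (iffP idP) => [le_sr | Ar]; first exact: has_decomposition_leq As.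
by apply: s_min; apply/asboolP.
Qed.

Definition sqrt_tensor (K : fieldType) (c : K) : tensor3 K 2 2 2 :=
  [ffun p : 'I_2 * 'I_2 * 'I_2 =>
     if p.2 == 0 then (p.1.1 == p.1.2)%:R
     else if p.1.1 == p.1.2 then 0 else if p.1.1 == 0 then c else 1].

Lemma map_sqrt_tensor (K L : fieldType) (f : {rmorphism K -> L}) (c : K) :
  map_tensor3 f (sqrt_tensor c) = sqrt_tensor (f c).
Proof.
apply/ffunP => p; rewrite !ffunE.
by do !case: ifP => _; rewrite ?rmorph_nat ?rmorph0 ?rmorph1.
Qed.

Lemma sqrt_tensor_decomposition (K : fieldType) (s : K) :
  2%:R != 0 :> K -> s != 0 -> has_decomposition (sqrt_tensor (s ^+ 2)) 2.
Proof.
move=> nz2 nzs.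
pose e (a : 'I_2) : K := (-1) ^+ a * s.
(* [x a] and [y a] are right and left eigenvectors of [M] for [e a], scaled to be dual bases. The
   products of [x a] and [y a] are thus the spectral projectors: they sum to the identity and,
   weighted by [e a], to [M]. *)
exists (fun a => \row_i if i == 0 then e a else 1).
exists (fun a => \row_j if j == 0 then (2%:R * e a)^-1 else 2%:R^-1).
exists (fun a => \row_k if k == 0 then 1 else e a).
apply/ffunP => -[[i j] k]; rewrite sum_ffunE !big_ord_recl big_ord0 !ffunE !mxE.
rewrite /e /= expr0 expr1.
by case: i => -[|[|//]] ?; case: j => -[|[|//]] ?; case: k => -[|[|//]] ? /=;
  field; rewrite ?nz2 ?nzs ?oppr_eq0 ?oner_eq0.
Qed.

Lemma sqrt_of_sqrt_tensor_decomposition (K : fieldType) (c : K) :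
  has_decomposition (sqrt_tensor c) 2 -> exists s, s ^+ 2 = c.
Proof.
move=> [x [y [z defA]]].
have E i j k : sqrt_tensor c (i, j, k) =
    x 0 0 i * y 0 0 j * z 0 0 k + x 1 0 i * y 1 0 j * z 1 0 k.
  rewrite defA sum_ffunE !big_ord_recl big_ord0 !ffunE addr0 /=.
  by rewrite (_ : lift _ _ = 1) //; apply/val_inj.
pose slice u v i j := u * sqrt_tensor c (i, j, 0) + v * sqrt_tensor c (i, j, 1).
pose d := (x 0 0 0 * x 1 0 1 - x 0 0 1 * x 1 0 0)
  * (y 0 0 0 * y 1 0 1 - y 0 0 1 * y 1 0 0).
have detE u v : u ^+ 2 - c * v ^+ 2 =
    d * (u * z 0 0 0 + v * z 0 0 1) * (u * z 1 0 0 + v * z 1 0 1).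
  transitivity (slice u v 0 0 * slice u v 1 1 - slice u v 0 1 * slice u v 1 0).
    by rewrite /slice !ffunE /=; ring.
  (* By [E] the slice is a product X^T D Y with D diagonal, so its determinant factors. *)
  by rewrite /slice !E /d; ring.
have nz_z00 : z 0 0 0 != 0.
  (* At (u, v) = (1, 0) the left side of [detE] is 1, so no factor on the right can vanish. *)
  apply/eqP => z00; have /eqP := detE 1 0.
  rewrite z00 !mul0r mulr0 addr0 mulr0 mul0r expr1n expr0n mulr0 subr0.
  by rewrite oner_eq0.
exists (z 0 0 1 / z 0 0 0); rewrite expr_div_n.
apply: (canLR (mulfK _)); first by rewrite expf_neq0.
(* The sign change makes [detE] apply at u = [z 0 0 1], v = [- z 0 0 0], where the factor from [z 0]
   vanishes. *)
apply/eqP; rewrite -subr_eq0 -[X in _ - _ * X]sqrrN detE.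
by apply/eqP; ring.
Qed.

(** The exponent of 2 is even in the squared numerator but odd in twice the squared denominator; a
    zero numerator fits in, as [logn 2 0] is 0. *)
Lemma rat_sqr_neq2 (q : rat) : q ^+ 2 != 2%:R.
Proof.
apply/eqP => q2.
have /(congr1 absz) : numq q ^+ 2 = 2%:R * denq q ^+ 2.
  apply: (@intr_inj rat); rewrite [RHS]rmorphM !rmorphXn /= rmorph_nat -q2.
  by rewrite numqE exprMn.
rewrite abszM !abszX => /(congr1 (logn 2)).
have d0 : (0 < `|denq q|)%N by rewrite absz_gt0 denq_neq0.
rewrite lognM ?expn_gt0 ?d0 // !lognX /= => /(congr1 odd).
by rewrite oddD !oddM.
Qed.

Theorem theorem9p1 (R : realType) :
  exists (l m n : nat) (A : tensor3 rat l m n),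
    (tensor_rank (map_tensor3 (ratr : rat -> R) A) < tensor_rank A)%N.
Proof.
exists 2, 2, 2, (sqrt_tensor 2%:R).
apply: (@leq_ltn_trans 2).
  apply/tensor_rank_leP; rewrite map_sqrt_tensor /= ratr_nat.
  rewrite -(sqr_sqrtr (ler0n R 2)).
  by apply: sqrt_tensor_decomposition; rewrite ?pnatr_eq0 // gt_eqF // sqrtr_gt0 ltr0n.
rewrite ltnNge; apply/negP => /tensor_rank_leP.
by move=> /sqrt_of_sqrt_tensor_decomposition[s /eqP]; apply/negP/rat_sqr_neq2.
Qed.
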